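(* Let $\nu$ be a probability measure on $[0,1]$ that is absolutely continuous with respect to Lebesgue measure, $d\nu(t)=g(t)\,dt$ with $g\in L^1([0,1])$, and let $\mu=\nu^2$. Then $\mu$ is absolutely continuous with respect to Lebesgue measure on $[0,1]$, $d\mu(t)=f(t)\,dt$, where $$f(a)=\int_a^1 g\!\left(\frac{a}{x}\right)g(x)\,\frac1x\,dx\quad\text{for a.e. } a\in(0,1).$$
   Context: For a positive Borel measure $\nu$ with compact support in $[0,\infty)$, $\nu^2$ denotes the unique positive compactly supported Borel measure $\mu$ on $[0,\infty)$ with $\int t^n\,d\mu(t)=\left(\int t^n\,d\nu(t)\right)^2$ for all integers $n\ge0$; equivalently $\mu=(\nu\times\nu)\circ p^{-1}$ with $p(x,y)=xy$. *)

(* Defs.v *)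
From HB Require Import structures.
From mathcomp Require Import all_boot all_order all_algebra.
From mathcomp Require Import all_classical all_reals all_analysis.
Import Order.TTheory GRing.Theory Num.Theory.
Import numFieldNormedType.Exports.

Set Implicit Arguments.
Unset Strict Implicit.
Unset Printing Implicit Defensive.

Local Open Scope classical_set_scope.
Local Open Scope ring_scope.

Definition compact_support_nonneg (R : realType)
    (m : {measure set (measurableTypeR R) -> \bar R}) : Prop :=
  exists K : set R, [/\ compact K, K `<=` `[0, +oo[ & m (~` K) = 0%E].

(* [measure_square nu mu] says that mu is nu^2.  For nu finite and compactly
   supported in [0, +oo[ the moment conditions determine mu, and the condition
   at n = 0 makes mu finite. *)
Definition measure_square (R : realType)
    (nu mu : {measure set (measurableTypeR R) -> \bar R}) : Prop :=
  compact_support_nonneg mu /\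
  forall n : nat,
    (\int[mu]_t (t ^+ n)%:E = (\int[nu]_t (t ^+ n)%:E) ^+ 2)%E.

(* m is carried by [0, 1], is absolutely continuous with respect to Lebesgue
   measure, and dm(t) = h(t) dt with h in L^1([0, 1]).  The values of h outside
   [0, 1] are irrelevant. *)
Definition abs_continuous01 (R : realType)
    (m : {measure set (measurableTypeR R) -> \bar R}) (h : R -> R) : Prop :=
  [/\ m (~` `[0, 1]) = 0%E,
      m `<< (@lebesgue_measure R),
      (@lebesgue_measure R).-integrable `[0, 1] (EFin \o h) &
      forall A : set R, measurable A -> A `<=` `[0, 1] ->
        m A = (\int[@lebesgue_measure R]_(t in A) (h t)%:E)%E].

(* Main.v *)
Require Import Defs.
From HB Require Import structures.
From mathcomp Require Import all_boot all_order all_algebra.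
From mathcomp Require Import all_classical all_reals all_analysis.
From mathcomp Require Import measurable_realfun ring lra.
Import Order.TTheory GRing.Theory Num.Theory.
Import numFieldNormedType.Exports.

Local Open Scope classical_set_scope.
Local Open Scope ring_scope.

(** The multiplicative convolution square of nu, i.e. the image of nu x nu under
    (x, y) |-> x y, is carried by [0, 1] and its moments are the squares of the
    moments of nu. The measure mu has the same moments; as they are at most 1,
    Markov's inequality applied to t ^ (2n) shows that mu is carried by [0, 1]
    too, so both measures coincide by uniqueness in the Hausdorff moment
    problem. Finally Tonelli and the dilation a = x y turn the image measure
    into the density \int h(a / x) h(x) / x dx, where h is the (nonnegative)
    Radon-Nikodym derivative of nu, which agrees with g almost everywhere. *)

(** * Polynomial approximation of a step function *)

Lemma bernoulli_ge (R : realDomainType) (x : R) n :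
  -1 <= x -> 1 + x *+ n <= (1 + x) ^+ n.
Proof.
move=> x1; elim: n => [|n IH]; first by rewrite mulr0n addr0 expr0.
have x0 : 0 <= 1 + x by rewrite -lerBlDl sub0r.
rewrite exprS (le_trans _ (ler_wpM2l x0 IH))//.
rewrite -!(mulr_natr x) -natr1; have : 0 <= n%:R * x ^+ 2 by rewrite mulr_ge0// sqr_ge0.
by nra.
Qed.

(* With q = (1 + s) / 2, the first factor tends to 1 if q < 1/2 and to 0 if
   q > 1/2; the second factor tends to 1, except at s = 0 where it vanishes. *)
Definition threshold (R : realType) n (s : R) : R :=
  (1 - ((1 + s) / 2) ^+ n) ^+ (2 ^ n) * (1 - (1 - s ^+ 2) ^+ n).

Lemma threshold_itv (R : realType) n (s : R) : -1 <= s <= 1 ->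
  0 <= threshold R n s <= 1.
Proof.
move=> /andP[s1 s2].
have q0 : 0 <= (1 + s) / 2 <= 1 by apply/andP; split; lra.
have s0 : 0 <= 1 - s ^+ 2 <= 1 by apply/andP; split; nra.
move: q0 s0 => /andP[q0 q1] /andP[s0 s3].
have a0 : 0 <= 1 - ((1 + s) / 2) ^+ n <= 1.
  by rewrite subr_ge0 gerBl exprn_ge0// exprn_ile1.
have b0 : 0 <= 1 - (1 - s ^+ 2) ^+ n <= 1.
  by rewrite subr_ge0 gerBl exprn_ge0// exprn_ile1.
move: a0 b0 => /andP[a0 a1] /andP[b0 b1].
by rewrite mulr_ge0 ?exprn_ge0//= mulr_ile1 ?exprn_ge0// exprn_ile1.
Qed.

Lemma cvg_threshold (R : realType) (s : R) : -1 <= s <= 1 ->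
  threshold R n s @[n --> \oo] --> ((s < 0)%R%:R : R).
Proof.
move=> /andP[s1 s2].
have q0 : 0 <= (1 + s) / 2 <= 1 by apply/andP; split; lra.
set q := (1 + s) / 2 in q0 *; have /andP[{}q0 q1] := q0.
have [s0|s0|->] := ltgtP s 0; last first.
- rewrite /threshold expr0n/= subr0 addr0.
  under eq_fun do rewrite expr1n subrr mulr0.
  exact: cvg_cst.
- have qn n : 0 <= 1 - q ^+ n <= 1.
    by rewrite subr_ge0 gerBl exprn_ge0// exprn_ile1.
  (* Here 2q > 1. Since (1 - q^n)(1 + q^n) <= 1, the first factor is at most (1 + q^n)^-(2^n), and
     Bernoulli gives (1 + q^n)^(2^n) >= 1 + 2^n q^n >= (2q)^n. *)
  apply: (@squeeze_cvgr _ _ _ _ (cst 0) (fun n => (2 * q)^-1 ^+ n)).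
  + apply: nearW => n; rewrite (andP (threshold_itv _ _ _ _)).1 ?s1//=.
    have /andP[a0 a1] := qn n.
    have t1 : 1 - (1 - s ^+ 2) ^+ n <= 1 by rewrite gerBl exprn_ge0//; nra.
    rewrite /threshold -/q (@le_trans _ _ ((1 - q ^+ n) ^+ (2 ^ n)))//.
      by rewrite ler_piMr// exprn_ge0.
    have qp : 0 < q by rewrite /q; lra.
    have h : (1 - q ^+ n) ^+ (2 ^ n) * (1 + q ^+ n) ^+ (2 ^ n) <= 1.
      rewrite -exprMn exprn_ile1//.
        by rewrite mulr_ge0// addr_ge0// exprn_ge0.
      by have := sqr_ge0 (q ^+ n); nra.
    have b : (2 * q) ^+ n <= (1 + q ^+ n) ^+ (2 ^ n).
      apply: le_trans (bernoulli_ge _ _ _ _); last first.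
        by rewrite (@le_trans _ _ 0)// ?exprn_ge0// lerN10.
      by rewrite exprMn -[X in _ <= 1 + X]mulr_natl natrX lerDr.
    have qq : 0 < (2 * q) ^+ n by rewrite exprn_gt0// mulr_gt0.
    rewrite exprVn -[leRHS]mul1r ler_pdivlMr//.
    apply: le_trans h; rewrite ler_wpM2l// exprn_ge0//.
  + exact: cvg_cst.
  + have q2 : 1 < 2 * q by rewrite /q; lra.
    have q20 : 0 < 2 * q by exact: lt_trans q2.
    by apply: cvg_expr; rewrite ger0_norm ?invr_ge0 ?ltW// invf_lt1.
- suff: threshold R n s @[n --> \oo] --> (1 * (1 - 0) : R).
    by rewrite subr0 mul1r.
  apply: cvgM; last first.
    apply: cvgB; first exact: cvg_cst.
    by apply: cvg_expr; rewrite ger0_norm; nra.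
  (* Here 2q < 1, and Bernoulli at -q^n bounds the first factor below by 1 - 2^n q^n. *)
  apply: (@squeeze_cvgr _ _ _ _ (fun n => 1 - (2 * q) ^+ n) (cst 1)).
  + apply: nearW => n; apply/andP; split; last first.
      by rewrite exprn_ile1 ?subr_ge0 ?gerBl ?exprn_ge0 ?exprn_ile1.
    apply: le_trans (bernoulli_ge _ _ _ _); last first.
      by rewrite lerN2 exprn_ile1.
    by rewrite exprMn mulNrn -[X in _ <= 1 - X]mulr_natl natrX.
  + suff: 1 - (2 * q) ^+ n @[n --> \oo] --> (1 - 0 : R) by rewrite subr0.
    apply: cvgB; first exact: cvg_cst.
    by apply: cvg_expr; rewrite ger0_norm ?mulr_ge0 ?/q; lra.
  + exact: cvg_cst.
Qed.

(** * Uniqueness of a measure on [0, 1] with given moments *)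

Lemma integral_carried d (T : measurableType d) (R : realType)
    (m : {measure set T -> \bar R}) (D : set T) (f : T -> \bar R) :
  measurable D -> m (~` D) = 0%E -> measurable_fun [set: T] f ->
  (\int[m]_t f t = \int[m]_(t in D) f t)%E.
Proof.
move=> mD mD0 mf; have mDC : measurable (~` D) by exact: measurableC.
rewrite -(setUv D) integral_setU ?setUv//; last by apply/disj_setPS; rewrite setICr.
by rewrite (null_set_integral mDC _ mD0) ?adde0//; exact: measurable_funTS.
Qed.

Arguments integral_carried {d T R m D f}.

Lemma measure_carried d (T : measurableType d) (R : realType)
    (m : {measure set T -> \bar R}) (D B : set T) :
  measurable D -> m (~` D) = 0%E -> measurable B -> m B = m (D `&` B).
Proof.
move=> mD m0 mB; rewrite (measureDI _ mB mD) setIC.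
rewrite (@subset_measure0 _ _ _ _ _ (~` D)) ?add0e//.
  exact: measurableD.
exact: measurableC.
Qed.

Arguments measure_carried {d T R m D B}.

(** Dividing by 1 + |c| keeps s in [-1, 1] for every t in [0, 1] and every real c, without changing
    the sign of t - c. *)
Definition threshold_poly (R : realType) n (c : R) : {poly R} :=
  let s := ('X - c%:P) * ((1 + `|c|)^-1)%:P in
  (1 - ((1 + s) * (2^-1)%:P) ^+ n) ^+ (2 ^ n) * (1 - (1 - s ^+ 2) ^+ n).

Lemma horner_threshold_poly (R : realType) n (c t : R) :
  (threshold_poly R n c).[t] = threshold R n ((t - c) / (1 + `|c|)).
Proof. by rewrite /threshold_poly /threshold !hornerE. Qed.

Lemma moment_integrable (R : realType)
    (m : {measure set (measurableTypeR R) -> \bar R}) (n : nat) :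
  (m setT < +oo)%E ->
  m.-integrable `[0, 1] (fun t : R => (t ^+ n)%:E).
Proof.
move=> moo; apply: measurable_bounded_integrable => //.
- by rewrite (le_lt_trans _ moo)// le_measure ?inE.
- exists 1; split => // x x1 t /=; rewrite in_itv/= => /andP[t0 t1].
  by rewrite ger0_norm ?exprn_ge0// (le_trans _ (ltW x1))// exprn_ile1.
Qed.

Lemma integral_poly (R : realType)
    (m : {measure set (measurableTypeR R) -> \bar R}) (p : {poly R}) :
  (m setT < +oo)%E ->
  (\int[m]_(t in `[0%R, 1%R]) (p.[t])%:E =
   \sum_(i < size p) (p`_i)%:E * \int[m]_(t in `[0%R, 1%R]) (t ^+ i)%:E)%E.
Proof.
move=> moo; have int i := moment_integrable _ m i moo.
under eq_integral do rewrite horner_coef -sumEFin.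
rewrite integral_sum//.
- by apply: eq_bigr => i _; under eq_integral do rewrite EFinM; rewrite integralZl.
- by move=> i; apply: (@integrableZl _ _ _ m _ _ p`_i _ (int i)).
Qed.

(** Dominated convergence with bound 1, integrable because m is finite. The half-line is open
    because [threshold] tends to 0 at s = 0. *)
Lemma cvg_integral_threshold (R : realType)
    (m : {measure set (measurableTypeR R) -> \bar R}) (c : R) :
  (m setT < +oo)%E ->
  (\int[m]_(t in `[0%R, 1%R]) ((threshold_poly R n c).[t])%:E)%E @[n --> \oo]
  --> m (`[0, 1] `&` `]-oo, c[).
Proof.
move=> moo; rewrite setIC -integral_indic//.
have c0 : 0 < 1 + `|c| by rewrite ltr_pwDl.
have s1 t : 0 <= t <= 1 -> -1 <= (t - c) / (1 + `|c|) <= 1.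
  move=> /andP[t0 t1]; rewrite ler_pdivlMr// ler_pdivrMr//.
  have := ler_norm c; have := ler_norm (- c); rewrite normrN => ? ?.
  by apply/andP; split; lra.
have := @dominated_convergence _ _ R m `[0%R, 1%R]%classic _
  (fun n t => ((threshold_poly R n c).[t])%:E) (fun t => (\1_(`]-oo, c[%classic) t)%:E)
  (cst 1%E) _ _ _ _ _.
case=> //.
- move=> n; apply: measurable_funTS; apply/measurable_EFinP.
  exact: continuous_measurable_fun (@continuous_horner _ _).
- by apply: measurable_funTS; apply/measurable_EFinP.
- apply: aeW => t /=; rewrite in_itv/= => t01.
  apply/cvg_EFin; first exact: nearW.
  under eq_fun do rewrite /= horner_threshold_poly.
  have := cvg_threshold _ _ (s1 _ t01).
  rewrite indicE mem_setE in_itv/= pmulr_llt0 ?invr_gt0// subr_lt0.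
  exact.
- apply/integrableP; split => //.
  under eq_integral do rewrite /= normr1.
  by rewrite integral_cst// mul1e (le_lt_trans _ moo)// le_measure ?inE.
- apply: aeW => t n /=; rewrite in_itv/= => t01.
  have /andP[h0 h1] := threshold_itv _ n _ (s1 _ t01).
  by rewrite horner_threshold_poly lee_fin ger0_norm.
Qed.

(* Hausdorff moment problem: polynomials on [0, 1] approximate boundedly the
   indicator functions of half-lines. *)
Lemma moments_unique (R : realType)
    (m1 m2 : {measure set (measurableTypeR R) -> \bar R}) :
  (m1 setT < +oo)%E -> m1 (~` `[0, 1]) = 0%E -> m2 (~` `[0, 1]) = 0%E ->
  (forall n, \int[m1]_t (t ^+ n)%:E = \int[m2]_t (t ^+ n)%:E)%E ->
  forall A, measurable A -> m1 A = m2 A.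
Proof.
move=> m1oo m10 m20 m12.
have m12T : m1 setT = m2 setT.
  by have := m12 0%N; under eq_integral do rewrite expr0;
    under [in RHS]eq_integral do rewrite expr0; rewrite !integral_cst// !mul1e.
have m2oo : (m2 setT < +oo)%E by rewrite -m12T.
have m12_01 n : (\int[m1]_(t in `[0%R, 1%R]) (t ^+ n)%:E =
    \int[m2]_(t in `[0%R, 1%R]) (t ^+ n)%:E)%E.
  have mX : measurable_fun [set: measurableTypeR R] (fun t : R => (t ^+ n)%:E).
    by apply/measurable_EFinP; exact: measurable_funX.
  rewrite -(integral_carried _ m10 mX)//.
  by rewrite -(integral_carried _ m20 mX).
(* The open half-lines ]-oo, c[ form a pi-system generating the Borel sets, and those with natural c
   exhaust the line. *)
move=> A mA; apply: (@measure_unique _ _ (measurableTypeR R) (@RGenInftyO.G R)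
  (fun k => `]-oo, k%:R[%classic) _ _ _ _ m1 m2) mA.
- exact: RGenInftyO.measurableE.
- move=> _ _ [x ->] [y ->]; exists (Order.min x y).
  by apply/seteqP; split => z /=; rewrite !in_itv/= lt_min => /andP.
- by move=> k; exists k%:R.
- rewrite -subTset => x _; exists (Num.truncn `|x|).+1 => //=.
  by rewrite in_itv/= (le_lt_trans (ler_norm _))// truncnS_gt.
- move=> _ [c ->]; rewrite (measure_carried _ m10)//.
  rewrite [RHS](measure_carried _ m20)//.
  have h1 := cvg_integral_threshold _ m1 c m1oo.
  have h2 := cvg_integral_threshold _ m2 c m2oo.
  (* Both limits come from one sequence, as the integral of a polynomial depends only on the
     moments. *)
  suff h12 : (fun n => \int[m1]_(t in `[0%R, 1%R]) ((threshold_poly R n c).[t])%:E)%E =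
      (fun n => \int[m2]_(t in `[0%R, 1%R]) ((threshold_poly R n c).[t])%:E)%E.
    by rewrite h12 in h1; exact: cvg_unique h1 h2.
  apply/funext => n; rewrite !integral_poly//.
  by apply: eq_bigr => i _; rewrite m12_01.
- by move=> k; rewrite (le_lt_trans _ m1oo)// le_measure ?inE.
Qed.

(** * Locating a measure from its moments *)

(** Markov's inequality gives c^(2n) m([c, +oo[) <= 1 for all n, while c^(2n) is unbounded. Even
    powers keep the integrand nonnegative on the whole line, where m may still have mass. *)
Lemma even_moments_null (R : realType)
    (m : {measure set (measurableTypeR R) -> \bar R}) (c : R) : 1 < c ->
  (forall n, \int[m]_t (t ^+ (2 * n))%:E <= 1)%E -> m `[c, +oo[%classic = 0%E.
Proof.
move=> c1 mom.
have c0 : 0 <= c by rewrite ltW// (lt_trans _ c1).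
have le1 n : ((c ^+ (2 * n))%:E * m `[c, +oo[%classic <= 1)%E.
  apply: le_trans (mom n); rewrite -integral_cst//.
  have me : measurable_fun setT (fun t : R => (t ^+ (2 * n))%:E).
    by apply/measurable_EFinP; exact: measurable_funX.
  apply: (@le_trans _ _ (\int[m]_(t in `[c, +oo[) (t ^+ (2 * n))%:E)%E); last first.
    by apply: ge0_subset_integral => // t _; rewrite lee_fin exprM exprn_ge0// sqr_ge0.
  apply: ge0_le_integral => //=.
  - by move=> t _; rewrite lee_fin exprn_ge0.
  - exact: measurable_funTS.
  - move=> t; rewrite in_itv/= andbT => ct.
    by rewrite lee_fin lerXn2r// nnegrE// (le_trans c0).
have : m `[c, +oo[%classic \is a fin_num.
  have := le1 0%N; rewrite muln0 expr0 mul1e => le1'.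
  by rewrite ge0_fin_numE// (le_lt_trans le1')// ltry.
have : (0 <= m `[c, +oo[%classic)%E by [].
case: (m `[c, +oo[%classic) le1 => // v le1; rewrite lee_fin => v0 _; congr EFin.
apply/eqP; rewrite eq_le v0 andbT leNgt; apply/negP => vp.
(* With n v (c - 1) > 1, Bernoulli makes v c^(2n) at least v (1 + 2n (c - 1)) > 1, against [le1]. *)
have [n nP] : exists n, (v * (c - 1))^-1 < n%:R :> R.
  exists (Num.truncn `|(v * (c - 1))^-1|).+1.
  by rewrite (le_lt_trans (ler_norm _))// truncnS_gt.
have w0 : 0 < v * (c - 1) by rewrite mulr_gt0// subr_gt0.
have {}nP : 1 < n%:R * (v * (c - 1)) by rewrite -ltr_pdivrMr// div1r.
have := le1 n; rewrite -EFinM lee_fin => le1n.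
have b := bernoulli_ge _ (c - 1) (2 * n) ltac:(lra).
rewrite -mulr_natr natrM (_ : (1 + (c - 1)) ^+ _ = c ^+ (2 * n)) in b;
  last by congr (_ ^+ _); lra.
suff : v * (1 + (c - 1) * (2 * n%:R)) <= 1 by nra.
by rewrite (le_trans _ le1n)// mulrC ler_wpM2r.
Qed.

Lemma carried01 (R : realType)
    (m : {measure set (measurableTypeR R) -> \bar R}) :
  m `]-oo, 0[%classic = 0%E -> (forall n, \int[m]_t (t ^+ (2 * n))%:E <= 1)%E ->
  m (~` `[0, 1]) = 0%E.
Proof.
move=> m0 mom.
pose F k : set (measurableTypeR R) := `[1 + k.+1%:R^-1, +oo[%classic.
have mF : m.-negligible (\bigcup_k F k).
  apply: negligible_bigcup => k; exists (F k); split => //.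
  - exact: measurable_itv.
  - by apply: even_moments_null => //; rewrite ltrDl invr_gt0.
have mN : m.-negligible (`]-oo, 0[ : set (measurableTypeR R)).
  by exists `]-oo, 0[%classic; split.
apply: measure_negligible; first exact: measurableC.
apply: negligibleS (negligibleU mN mF) => t /=; rewrite in_itv/= => /negP.
rewrite negb_and -!ltNge => /orP[t0|t1]; first by left; rewrite /= in_itv.
(* For t > 1 the index k = floor(1 / (t - 1)) works: 1 / (t - 1) < k + 1, and [F k] starts at 1 + 1
   / (k + 1). *)
right; exists (Num.truncn `|(t - 1)^-1|) => //; rewrite /F/= in_itv/= andbT.
rewrite -lerBrDl invf_ple ?posrE ?subr_gt0//.
by rewrite (le_trans (ler_norm _))// ltW// truncnS_gt.
Qed.

(** * Dilations of Lebesgue measure, and inversion *)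

Section scale.
Context (R : realType) (y : R).
Hypothesis y0 : 0 < y.

Let scale (u : measurableTypeR R) : measurableTypeR R := y * u.

Let measurable_scale : measurable_fun [set: measurableTypeR R] scale.
Proof. exact: measurable_funM. Qed.

(* The canonical instance is named explicitly because unification cannot find
   the measurability proof [pushforward] needs to be a measure. *)
Let scaled : {measure set (measurableTypeR R) -> \bar R} :=
  mscale (NngNum (ltW y0))
    (measure_function_pushforward__canonical__measure_function_Measure
       lebesgue_measure measurable_scale).

(** Lebesgue measure is determined by its values on ]a, b]; the preimage ]a / y, b / y] has length
    (b - a) / y, which the factor y compensates. *)
Let lebesgue_measure_scale A : measurable A -> lebesgue_measure A = scaled A.
Proof.
apply: lebesgue_measure_unique => _ [[a b]] _ <-.
rewrite /scaled/= /mscale/= /pushforward/=.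
have -> : scale @^-1` `]a, b] = `]a / y, b / y]%classic.
  apply/seteqP; split => u /=;
    by rewrite /scale !in_itv/= (mulrC y) ltr_pdivrMr// ler_pdivlMr.
rewrite !lebesgue_measure_itv/= !lte_fin ltr_pM2r ?invr_gt0//.
case: ifPn => _; last by rewrite mule0.
by rewrite -!EFinB -mulrBl -EFinM mulrC divfK ?gt_eqF.
Qed.

Lemma ge0_integral_scale (f : R -> \bar R) :
  measurable_fun [set: measurableTypeR R] f -> (forall x, 0 <= f x)%E ->
  (\int[@lebesgue_measure R]_a f (a / y)%R =
   y%:E * \int[@lebesgue_measure R]_u f u)%E.
Proof.
move=> mf f0.
have mg : measurable_fun [set: measurableTypeR R]
    (fun a : measurableTypeR R => f (a / y)).
  by apply: measurableT_comp => //; exact: measurable_funM.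
rewrite (@eq_measure_integral _ _ _ _ scaled);
  last by move=> A mA _; exact: lebesgue_measure_scale.
rewrite ge0_integral_mscale//; congr (_ * _)%E.
rewrite ge0_integral_pushforward//.
by apply: eq_integral => u _ /=; rewrite /scale mulrC mulKf ?gt_eqF.
Qed.

End scale.

(** Inversion is continuous off 0, and the remaining piece is a single point. *)
Lemma measurable_inv (R : realType) :
  measurable_fun [set: R] (fun x : R => x^-1).
Proof.
rewrite -(setUv [set~ (0 : R)]); apply/measurable_funU;
  [exact: measurableC|by rewrite setCK|].
split; last by rewrite setCK; exact: measurable_fun_set1.
apply: open_continuous_measurable_fun.
  by apply: closed_openC; exact: closed_eq.
by move=> x /[!inE] /eqP x0; exact: inv_continuous.
Qed.

(** * A nonnegative Borel density of nu *)

(** [g] may be negative on a null set and is arbitrary outside [0, 1]. Tonelli calls for a version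
    that is nonnegative and measurable everywhere; its vanishing for t <= 0 later absorbs the sign
    of 1 / x. *)
Lemma density_exists (R : realType)
    (nu : probability (measurableTypeR R) R) (g : R -> R) :
  abs_continuous01 nu g ->
  exists h : R -> R,
    [/\ measurable_fun [set: measurableTypeR R] h, forall t, 0 <= h t,
        forall t, ~~ (0 < t <= 1) -> h t = 0,
        {ae @lebesgue_measure R, forall t, 0 <= t <= 1 -> h t = g t} &
        forall phi : R -> \bar R, measurable_fun [set: measurableTypeR R] phi ->
          (forall t, 0 <= phi t)%E ->
          (\int[nu]_t phi t = \int[@lebesgue_measure R]_t (phi t * (h t)%:E))%E].
Proof.
move=> [nu01 numu ig nug].
pose rn := Radon_Nikodym_SigmaFinite.f nu (@lebesgue_measure R).
have rn0 t : (0 <= rn t)%E by exact: Radon_Nikodym_SigmaFinite.f_ge0.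
have rnf t : rn t \is a fin_num by exact: Radon_Nikodym_SigmaFinite.f_fin_num.
have rni := Radon_Nikodym_SigmaFinite.f_integrable numu.
have mrn : measurable_fun [set: measurableTypeR R] rn.
  by exact: (measurable_int lebesgue_measure).
pose h t := fine (rn t) * \1_(`]0, 1]%classic : set R) t.
have hE t : t \in (`]0, 1]%classic : set R) -> (h t)%:E = rn t.
  by move=> t01; rewrite /h indicE t01 mulr1 fineK.
have h0E t : t \notin (`]0, 1]%classic : set R) -> h t = 0.
  by move=> t01; rewrite /h indicE (negbTE t01) mulr0.
exists h; split.
- apply: measurable_funM; last exact: measurable_indic.
  by apply: measurableT_comp => //.
- by move=> t; rewrite mulr_ge0// fine_ge0.
- by move=> t t01; apply: h0E; rewrite mem_setE in_itv.
(* Both functions integrate to nu E over every measurable E in [0, 1]. *)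
- have : ae_eq (@lebesgue_measure R) `[0, 1]%classic rn (EFin \o g).
    apply: integral_ae_eq => //.
    + exact: (integrableS measurableT).
    + exact: (measurable_int lebesgue_measure).
    + by move=> E E01 mE; rewrite -Radon_Nikodym_SigmaFinite.f_integral// nug.
  (* The point 0 is discarded because [h] was set to 0 there, whatever the value of [g]. *)
  have n0 : (@lebesgue_measure R).-negligible [set 0].
    by exists [set 0]; split => //; exact: lebesgue_measure_set1.
  move=> nrn; apply: negligibleS (negligibleU nrn n0) => t /=.
  apply: contra_notP => /not_orP[/contrapT rng /eqP t0] /andP[t1 t2].
  apply: EFin_inj; rewrite hE; first by apply: rng; rewrite /= in_itv/= t1.
  by rewrite mem_setE in_itv/= t2 lt_neqAle eq_sym t0 t1.
- move=> phi mphi phi0.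
  (* Absolute continuity makes {0} a nu-null set, so nu is carried by ]0, 1], where [h] equals
     [rn]. *)
  have nu01' : nu (~` `]0, 1]) = 0%E.
    have -> : ~` `]0, 1]%classic = ~` `[0, 1]%classic `|` [set 0] :> set R.
      apply/seteqP; split => t /=; rewrite !in_itv/=.
        move=> /negP; rewrite negb_and -leNgt -ltNge.
        move=> /orP[|t1].
          rewrite (le_eqVlt t 0) => /orP[/eqP ->|t0]; first by right.
          by left; apply/negP; rewrite leNgt t0.
        by left; apply/negP; rewrite negb_and orbC -ltNge t1.
      by move=> [h01 /andP[t0 t1]|->]; [apply: h01; rewrite ltW|rewrite ltxx].
    apply: null_set_setU => //; first exact: measurableC.
    by move/null_content_dominatesP : numu; apply => //; exact: lebesgue_measure_set1.
  rewrite (integral_carried _ nu01' mphi)//.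
  rewrite -(Radon_Nikodym_SigmaFinite.change_of_variables numu)//;
    last exact: measurable_funTS.
  rewrite integral_mkcond; apply: eq_integral => t _.
  rewrite /patch; case: ifPn => t01; first by rewrite hE.
  by rewrite h0E// mule0.
Qed.

(** * The multiplicative convolution square of nu *)

(** With |t| the integrand is nonnegative on the whole line for odd n too, as the Tonelli-type
    lemmas require. *)
Lemma integral_abs_moment (R : realType)
    (m : {measure set (measurableTypeR R) -> \bar R}) (n : nat) :
  m (~` `[0, 1]) = 0%E ->
  (\int[m]_t (t ^+ n)%:E = \int[m]_t (`|t| ^+ n)%:E)%E.
Proof.
move=> m0.
have mX : measurable_fun [set: measurableTypeR R] (fun t : R => (t ^+ n)%:E).
  by apply/measurable_EFinP; exact: measurable_funX.
have mA : measurable_fun [set: measurableTypeR R] (fun t : R => (`|t| ^+ n)%:E).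
  by apply/measurable_EFinP; apply: measurable_funX; exact: normr_measurable.
rewrite (integral_carried _ m0 mX)// (integral_carried _ m0 mA)//.
by apply: eq_integral => t; rewrite inE/= in_itv/= => /andP[t0 _]; rewrite ger0_norm.
Qed.

Section multiplicative_square.
Context (R : realType) (nu : probability (measurableTypeR R) R).

Let mult (z : measurableTypeR R * measurableTypeR R) : measurableTypeR R := z.1 * z.2.

Let measurable_mult : measurable_fun setT mult.
Proof. by apply: measurable_funM; [exact: measurable_fst|exact: measurable_snd]. Qed.

Definition mul_square : {measure set (measurableTypeR R) -> \bar R} :=
  measure_function_pushforward__canonical__measure_function_Measure
    (nu \x nu)%E measurable_mult.

Lemma ge0_integral_mul_square (phi : R -> \bar R) :
  measurable_fun [set: measurableTypeR R] phi -> (forall t, 0 <= phi t)%E ->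
  (\int[mul_square]_t phi t = \int[nu]_x \int[nu]_y phi (x * y)%R)%E.
Proof.
move=> mphi phi0; rewrite ge0_integral_pushforward// preimage_setT.
rewrite fubini_tonelli1//; last by move=> ?; exact: phi0.
exact: (measurableT_comp mphi measurable_mult).
Qed.

Lemma measurable_integral_mult (phi : R -> \bar R) :
  measurable_fun [set: measurableTypeR R] phi -> (forall t, 0 <= phi t)%E ->
  measurable_fun [set: measurableTypeR R] (fun x : R => \int[nu]_y phi (x * y)%R)%E.
Proof.
move=> mphi phi0; apply: (measurable_fun_fubini_tonelli_F (phi \o mult)).
  exact: (measurableT_comp mphi measurable_mult).
by move=> z; exact: phi0.
Qed.

(** Because [0, 1] is stable under products, the indicator of its complement vanishes at x y for all
    x, y in [0, 1]. *)
Lemma mul_square_carried :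
  nu (~` `[0, 1]) = 0%E -> mul_square (~` `[0, 1]) = 0%E.
Proof.
move=> nu01; have m01 : measurable (~` `[0, 1] : set (measurableTypeR R)).
  by exact: measurableC.
have mi : measurable_fun [set: measurableTypeR R]
    (fun t => (\1_(~` `[0, 1]) t)%:E : \bar R).
  by apply/measurable_EFinP; exact: measurable_indic.
rewrite -(setIT (~` _)) -integral_indic// ge0_integral_mul_square//.
rewrite (integral_carried _ nu01)//; last first.
  exact: (measurable_integral_mult _ mi).
apply: integral0_eq => x; rewrite /= in_itv/= => x01.
rewrite (integral_carried _ nu01)//; last first.
  have mx : measurable_fun [set: measurableTypeR R]
    (fun t : measurableTypeR R => x * t : measurableTypeR R) by exact: mulrl_measurable.
  exact: (measurableT_comp mi mx).
apply: integral0_eq => y; rewrite /= in_itv/= => y01.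
rewrite indicE memNset//=; apply; rewrite /= in_itv/=.
by move: x01 y01 => /andP[x0 x1] /andP[y0 y1]; rewrite mulr_ge0//= mulr_ile1.
Qed.

Lemma mul_square_moment n : nu (~` `[0, 1]) = 0%E ->
  (\int[mul_square]_t (t ^+ n)%:E = (\int[nu]_t (t ^+ n)%:E) ^+ 2)%E.
Proof.
move=> nu01; rewrite !integral_abs_moment//; last exact: mul_square_carried.
have mA : measurable_fun [set: measurableTypeR R] (fun t : R => (`|t| ^+ n)%:E).
  by apply/measurable_EFinP; apply: measurable_funX; exact: normr_measurable.
rewrite ge0_integral_mul_square//.
under eq_integral do under eq_integral do rewrite normrM exprMn EFinM.
under eq_integral do rewrite ge0_integralZl//.
by rewrite ge0_integralZr// integral_ge0.
Qed.

End multiplicative_square.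

(** * The density of the convolution square *)

(** Integrating over the whole line makes this a Tonelli marginal of one kernel on the plane. If [h]
    vanishes off ]0, 1] and a > 0, only x in [a, 1] contributes. The value may be infinite, hence
    the codomain. *)
Definition mul_convolution (R : realType) (h : R -> R) (a : R) : \bar R :=
  (\int[@lebesgue_measure R]_x (h (a / x) * h x * x^-1)%:E)%E.

Section density.
Context (R : realType) (nu : probability (measurableTypeR R) R) (h : R -> R).
Hypothesis mh : measurable_fun [set: measurableTypeR R] h.
Hypothesis h0 : forall t, 0 <= h t.
Hypothesis h01 : forall t, ~~ (0 < t <= 1) -> h t = 0.
Hypothesis nuE : forall phi : R -> \bar R,
  measurable_fun [set: measurableTypeR R] phi -> (forall t, 0 <= phi t)%E ->
  (\int[nu]_t phi t = \int[@lebesgue_measure R]_t (phi t * (h t)%:E))%E.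

Let kernel (z : measurableTypeR R * measurableTypeR R) : \bar R :=
  (h (z.2 / z.1) * h z.1 * z.1^-1)%:E.

Let kernel_ge0 z : (0 <= kernel z)%E.
Proof.
rewrite /kernel lee_fin; have [z1|z1] := ltP 0 z.1.
  by rewrite !mulr_ge0// invr_ge0 ltW.
by rewrite (h01 z.1) ?mulr0 ?mul0r// negb_and -leNgt z1.
Qed.

Let measurable_kernel : measurable_fun setT kernel.
Proof.
have mV : measurable_fun setT (fun z : measurableTypeR R * measurableTypeR R => z.1^-1).
  exact: (measurableT_comp (measurable_inv R) measurable_fst).
have md : measurable_fun setT
    (fun z : measurableTypeR R * measurableTypeR R => z.2 / z.1 : measurableTypeR R).
  by apply: measurable_funM => //; exact: measurable_snd.
apply/measurable_EFinP; apply: measurable_funM => //; apply: measurable_funM.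
  exact: (measurableT_comp mh md).
exact: (measurableT_comp mh measurable_fst).
Qed.

Lemma mul_convolution_ge0 a : (0 <= mul_convolution R h a)%E.
Proof. by apply: integral_ge0 => x _; exact: (kernel_ge0 (x, a)). Qed.

Lemma measurable_mul_convolution :
  measurable_fun [set: measurableTypeR R] (mul_convolution R h).
Proof.
exact: (measurable_fun_fubini_tonelli_G kernel).
Qed.

Lemma mul_square_density (A : set (measurableTypeR R)) : measurable A ->
  mul_square R nu A = (\int[@lebesgue_measure R]_(a in A) mul_convolution R h a)%E.
Proof.
move=> mA.
have mi : measurable_fun [set: measurableTypeR R] (fun t => (\1_A t)%:E : \bar R).
  by apply/measurable_EFinP; exact: measurable_indic.
have i0 t : (0 <= (\1_A t)%:E :> \bar R)%E by rewrite lee_fin.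
rewrite -[in LHS](setIT A) -integral_indic// ge0_integral_mul_square//.
rewrite nuE//; [|exact: (measurable_integral_mult _ _ _ mi)|];
  last by move=> t; exact: integral_ge0.
pose k (z : measurableTypeR R * measurableTypeR R) := ((\1_A z.2)%:E * kernel z)%E.
have mk : measurable_fun setT k.
  by apply: emeasurable_funM => //; exact: (measurableT_comp mi measurable_snd).
have k0 z : (0 <= k z)%E by rewrite mule_ge0// kernel_ge0.
transitivity (\int[@lebesgue_measure R]_x \int[@lebesgue_measure R]_a k (x, a))%E.
  apply: eq_integral => x _; rewrite /k/=.
  have [x01|x01] := boolP (0 < x <= 1); last first.
    rewrite h01// mule0 integral0_eq// => a _.
    by rewrite /kernel/= (h01 x x01) mulr0 mul0r mule0.
  have x0 : 0 < x by case/andP : x01.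
  have mx : measurable_fun [set: measurableTypeR R]
    (fun t : measurableTypeR R => x * t : measurableTypeR R) by exact: mulrl_measurable.
  pose f u : \bar R := ((\1_A (x * u))%:E * (h u)%:E)%E.
  have mf : measurable_fun [set: measurableTypeR R] f.
    by apply: emeasurable_funM; [exact: (measurableT_comp mi mx)|exact/measurable_EFinP].
  have f0 u : (0 <= f u)%E by rewrite mule_ge0// lee_fin.
  rewrite nuE//; last exact: (measurableT_comp mi mx).
  (* For fixed x in ]0, 1], substitute a = x u: the factor x from the dilation cancels the 1 / x of
     the kernel. *)
  transitivity (\int[@lebesgue_measure R]_a ((h x / x)%:E * f (a / x)%R))%E; last first.
    apply: eq_integral => a _; rewrite /f /kernel/= mulrCA divff ?gt_eqF// mulr1.
    by rewrite -!EFinM; congr EFin; ring.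
  rewrite ge0_integralZl_EFin//; last 2 first.
    by apply: (measurableT_comp mf); exact: mulrr_measurable.
    by rewrite divr_ge0// ltW.
  rewrite ge0_integral_scale// muleA -EFinM divfK ?gt_eqF//.
  by rewrite muleC.
rewrite fubini_tonelli// [RHS]integral_mkcond; apply: eq_integral => a _.
rewrite /k/= ge0_integralZl//.
- by rewrite indicE patchE; case: ifPn => aA; rewrite ?mul1e ?mul0e.
- exact: (measurable_fun_pair1 a measurable_kernel).
Qed.
End density.

(** * Returning from [h] to [g] *)

(* Makes it legitimate to replace h by g under the integral sign: h(a / x) and
   g(a / x) differ only for x in a null set, for almost every a. *)
Lemma ae_null_dilation (R : realType) (N : set (measurableTypeR R)) :
  measurable N -> lebesgue_measure N = 0%E ->
  {ae @lebesgue_measure R, forall a : R,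
    (@lebesgue_measure R).-negligible [set x : R | 0 < x <= 1 /\ N (a / x)]}.
Proof.
move=> mN N0.
pose q (z : measurableTypeR R * measurableTypeR R) : measurableTypeR R := z.2 / z.1.
have mq : measurable_fun setT q.
  apply: measurable_funM; first exact: measurable_snd.
  exact: (measurableT_comp (measurable_inv R) measurable_fst).
pose I01 : set (measurableTypeR R) := `]0, 1]%classic.
pose S := fst @^-1` I01 `&` q @^-1` N.
have mS : measurable S.
  apply: measurableI; rewrite -[X in measurable X]setTI; last exact: mq.
  by apply: measurable_fst => //; exact: measurable_itv.
have mi : measurable_fun [set: measurableTypeR R] (fun t => (\1_N t)%:E : \bar R).
  by apply/measurable_EFinP; exact: measurable_indic.
pose k (z : measurableTypeR R * measurableTypeR R) : \bar R := (\1_S z)%:E.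
have mk : measurable_fun setT k by apply/measurable_EFinP; exact: measurable_indic.
have k0 z : (0 <= k z)%E by rewrite lee_fin.
(* Integrating over a first, the slice at x in ]0, 1] is the dilate x N, of measure x * 0. *)
have kI : (\int[@lebesgue_measure R]_a \int[@lebesgue_measure R]_x k (x, a) = 0)%E.
  rewrite -fubini_tonelli//; apply: integral0_eq => x _.
  have [x01|x01] := boolP (0 < x <= 1).
    rewrite -[RHS](mule0 x%:E) -N0 -(setIT N) -integral_indic//.
    rewrite -ge0_integral_scale//; last by case/andP : x01.
    apply: eq_integral => a _; rewrite /k !indicE; congr ((nat_of_bool _)%:R%:E).
    by apply/idP/idP; rewrite !inE /S /I01 /q /= in_itv/=; [case|].
  apply: integral0_eq => a _; rewrite /k indicE memNset//.
  by move=> []; rewrite /I01/= in_itv/= (negbTE x01).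
have mG := measurable_fun_fubini_tonelli_G (m1 := @lebesgue_measure R) k mk k0.
(* A nonnegative function with zero integral vanishes almost everywhere: almost every slice of [S]
   at fixed a is null. *)
have : (\int[@lebesgue_measure R]_a `| \int[@lebesgue_measure R]_x k (x, a)| = 0)%E.
  by rewrite -[RHS]kI; apply: eq_integral => a _; rewrite gee0_abs// integral_ge0.
move/(ae_eq_integral_abs _ measurableT mG).
apply: negligibleS => a /=; apply: contra_not => /(_ I) h.
have mSa : measurable (ysection S a) by exact: measurable_ysection.
exists (ysection S a); split => //.
  rewrite -(setIT (ysection S a)) -integral_indic// -[RHS]h.
  apply: eq_integral => x _; rewrite /k !indicE; congr ((nat_of_bool _)%:R%:E).
  by rewrite mem_ysection.
by move=> x /= [x01 Nx]; rewrite /ysection/= inE; split => //=; rewrite /I01/= in_itv.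
Qed.

(** Let N be a null set outside which [h] and [g] agree on [0, 1]. For almost every a the integrands
    can differ on [a, 1] only where x or a / x lies in N, which is a null set of x. *)
Lemma mul_convolutionE (R : realType) (g h : R -> R) :
  measurable_fun (`[0, 1]%classic : set (measurableTypeR R)) g ->
  measurable_fun [set: measurableTypeR R] h ->
  (forall t, ~~ (0 < t <= 1) -> h t = 0) ->
  {ae @lebesgue_measure R, forall t, 0 <= t <= 1 -> h t = g t} ->
  {ae @lebesgue_measure R, forall a : R, 0 < a < 1 ->
    mul_convolution R h a =
    (\int[@lebesgue_measure R]_(x in `[a, 1%R]) (g (a / x) * g x * (1 / x))%:E)%E}.
Proof.
move=> mg mh h01 [N [mN N0 hgN]].
apply: negligibleS (ae_null_dilation R N mN N0) => a /=.
apply: contra_not => Na /andP[a0 a1].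
have ax01 x : x \in (`[a, 1]%classic : set R) -> 0 <= x <= 1 /\ 0 <= a / x <= 1.
  rewrite mem_setE in_itv/= => /andP[ax x1]; have x0 := lt_le_trans a0 ax.
  by rewrite x1 (ltW x0) divr_ge0 ?(ltW a0) ?(ltW x0)// ler_pdivrMr ?mul1r.
(* [g] is measurable only on [0, 1]; its extension by 0 is measurable on the line. *)
pose g1 : measurableTypeR R -> R := g \_ (`[0, 1]%classic : set (measurableTypeR R)).
have mg1 : measurable_fun [set: measurableTypeR R] g1.
  by apply/(measurable_restrictT g); first exact: measurable_itv.
have g1E x : 0 <= x <= 1 -> g1 x = g x.
  by move=> x01; rewrite /g1 patchE mem_setE in_itv/= x01.
pose k (f : R -> R) x : \bar R := (f (a / x) * f x * x^-1)%:E.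
have mk (f : R -> R) : measurable_fun [set: measurableTypeR R] f ->
    measurable_fun [set: measurableTypeR R] (k f).
  move=> mf; apply/measurable_EFinP; apply: measurable_funM; last exact: measurable_inv.
  apply: measurable_funM => //.
  have md : measurable_fun [set: measurableTypeR R]
      (fun x : measurableTypeR R => a / x : measurableTypeR R).
    by apply: measurable_funM => //; exact: measurable_inv.
  exact: (measurableT_comp mf md).
(* Off [a, 1] the integrand is 0: [h x] vanishes if x <= 0 or x > 1, and 0 < x < a forces a / x >
   1. *)
transitivity (\int[@lebesgue_measure R]_(x in `[a, 1%R]) k h x)%E.
  rewrite [RHS]integral_mkcond; apply: eq_integral => x _.
  rewrite patchE; case: ifPn => //; rewrite mem_setE in_itv/= negb_and -!ltNge => xa1.
  rewrite /k; have [x0|x0] := ltP 0 x; last by rewrite (h01 x) ?mulr0 ?mul0r// ltNge x0.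
  case/orP : xa1 => [xa|x1];
    last by rewrite (h01 x) ?mulr0 ?mul0r// negb_and -!ltNge x1 orbT.
  by rewrite (h01 (a / x)) ?mul0r// negb_and -!ltNge (ltr_pdivlMr 1)// mul1r xa orbT.
transitivity (\int[@lebesgue_measure R]_(x in `[a, 1%R]) k g1 x)%E; last first.
  by apply: eq_integral => x /ax01[x01 xa01]; rewrite /k !g1E// div1r.
have Nn : (@lebesgue_measure R).-negligible N by exists N; split.
apply: ae_eq_integral => //.
- by apply: measurable_funTS; exact: mk.
- by apply: measurable_funTS; exact: mk.
- apply: negligibleS (negligibleU Na Nn) => x /= /not_implyP[xa].
  have [x01 xa01] := ax01 x (mem_set xa).
  apply: contra_notP => /not_orP[/not_andP ndil nx].
  have hg t : 0 <= t <= 1 -> ~ N t -> h t = g1 t.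
    move=> t01 nt; rewrite g1E//; move: t01; apply: contra_notP nt => htg.
    exact: hgN.
  rewrite /k !hg//; case: ndil => // ndil; exfalso; apply: ndil.
  move: xa; rewrite /= in_itv/= => /andP[ax ->].
  by rewrite (lt_le_trans a0 ax).
Qed.

(** * Identification of mu with the convolution square *)

Theorem proposition3p1 (R : realType)
    (nu : probability (measurableTypeR R) R) (g : R -> R)
    (hnu : abs_continuous01 nu g)
    (mu : {measure set (measurableTypeR R) -> \bar R})
    (hmu : measure_square nu mu) :
  exists2 f : R -> R, abs_continuous01 mu f &
    {ae @lebesgue_measure R, forall a : R, 0 < a < 1 ->
      (f a)%:E =
        (\int[@lebesgue_measure R]_(x in `[a, 1%R]) (g (a / x) * g x * (1 / x))%:E)%E}.
Proof.
have [nu01 _ ig _] := hnu.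
have [h [mh h0 h01 hg nuE]] := density_exists _ _ _ hnu.
have {hmu} [[K [cK K0 muK]] mom] := hmu.
have int0 (m : {measure set (measurableTypeR R) -> \bar R}) :
    (\int[m]_t (t ^+ 0)%:E = m setT)%E.
  by under eq_integral do rewrite expr0; rewrite integral_cst// mul1e.
have muT : mu setT = 1%E.
  rewrite -int0 mom int0; transitivity (1 ^+ 2 : \bar R)%E; last by rewrite expe2 mule1.
  by congr (_ ^+ 2)%E; exact: probability_setT.
have mX n : measurable_fun [set: measurableTypeR R] (fun t : R => (t ^+ n)%:E).
  by apply/measurable_EFinP; exact: measurable_funX.
have mom1 n : (\int[mu]_t (t ^+ (2 * n))%:E <= 1)%E.
  have X0 t : (0 <= (t ^+ (2 * n))%:E :> \bar R)%E.
    by rewrite lee_fin exprM exprn_ge0// sqr_ge0.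
  suff nu1 : (\int[nu]_t (t ^+ (2 * n))%:E <= 1)%E.
    by rewrite mom expe2 -[leRHS]mule1 lee_pmul// integral_ge0.
  rewrite (integral_carried _ nu01 (mX _))//.
  apply: (@le_trans _ _ (\int[nu]_(t in `[0%R, 1%R]) (cst 1 t))%E).
    apply: ge0_le_integral => //; first exact: measurable_funTS.
    by move=> t /=; rewrite in_itv/= => /andP[t0 t1]; rewrite lee_fin exprn_ile1.
  by rewrite integral_cst// mul1e probability_le1.
(* The support hypothesis excludes negative t, and the even moments exclude t > 1. *)
have mu01 : mu (~` `[0, 1]) = 0%E.
  apply: carried01 => //; apply: subset_measure0 muK; first exact: measurable_itv.
    apply: measurableC; exact: compact_measurable.
  move=> t /=; rewrite in_itv/= => t0 /K0 /=.
  by rewrite in_itv/= andbT leNgt t0.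
have muE A : measurable A ->
    mu A = (\int[@lebesgue_measure R]_(a in A) mul_convolution R h a)%E.
  move=> mA; rewrite -(mul_square_density _ nu _ mh h0 h01 nuE)//.
  apply: moments_unique => //; first by rewrite muT ltry.
  - exact: mul_square_carried.
  - by move=> n; rewrite mom; exact/esym/mul_square_moment.
have F0 a := mul_convolution_ge0 _ h h0 h01 a.
have mF := measurable_mul_convolution _ h mh h0 h01.
(* On the whole line [muE] gives total integral 1, so the convolution is finite almost everywhere
   and [fine] alters it only on a null set. *)
have iF : (@lebesgue_measure R).-integrable setT (mul_convolution R h).
  apply/integrableP; split => //; under eq_integral do rewrite gee0_abs//.
  by rewrite -muE// muT ltry.
have finF : {ae @lebesgue_measure R, forall a, setT a ->
    mul_convolution R h a \is a fin_num}.
  exact: integrable_ae.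
pose f a := fine (mul_convolution R h a).
have mf : measurable_fun [set: measurableTypeR R] (EFin \o f).
  by apply/measurable_EFinP; exact: measurableT_comp.
exists f; last first.
  have mg : measurable_fun (`[0, 1]%classic : set (measurableTypeR R)) g.
    by apply/measurable_EFinP; exact: (measurable_int lebesgue_measure).
  apply: negligibleS (negligibleU finF (mul_convolutionE _ g h mg mh h01 hg)) => a /=.
  apply: contra_notP => /not_orP[/contrapT fa /contrapT Fa] a01.
  by rewrite /f fineK ?fa// Fa.
split => //.
- apply/null_content_dominatesP => A mA A0; rewrite muE//.
  by apply: null_set_integral => //; exact: measurable_funTS.
- apply: (integrableS measurableT) => //.
  apply: le_integrable iF => // a _ /=.
  rewrite /f; case: (mul_convolution R h a) => //=.
  - by rewrite ?abse0 ?normr0 leey.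
  - by rewrite ?abse0 ?normr0 leey.
- move=> A mA _; rewrite muE//; apply: ae_eq_integral => //.
  + exact: measurable_funTS.
  + exact: measurable_funTS.
  + apply: negligibleS finF => a /=; apply: contra_not => /(_ I) fa _.
    by rewrite fineK.
Qed.
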